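(* Let $\overline{P}_1$ and $\overline{P}_2$ be two Preparata codes of the same length $n$. Then the minimal distance graphs of $\overline{P}_1$ and $\overline{P}_2$ are isomorphic if and only if $\overline{P}_1$ and $\overline{P}_2$ are isometric, i.e. there exists a map $I:\overline{P}_1\to\overline{P}_2$ with $d(I(x),I(y))=d(x,y)$ for all $x,y\in\overline{P}_1$.
   Context: $E^n$ is the set of binary vectors of length $n$ with the Hamming distance $d$. A Preparata code is a binary code of length $n=2^m$ ($m\ge 4$ even) with minimum distance (code distance) $6$ and maximum possible cardinality among binary codes of that length and minimum distance. The minimal distance graph of a code $C$ with code distance $d_C$ has the codewords of $C$ as vertices, two vertices being adjacent iff their Hamming distance equals $d_C$. *)

(* Defs.v *)
From mathcomp Require Import all_boot.
Set Implicit Arguments. Unset Strict Implicit. Unset Printing Implicit Defensive.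

Definition word (n : nat) := {ffun 'I_n -> bool}.

Definition hamming n (x y : word n) : nat := #|[set i | x i != y i]|.

Definition code_distance n (C : {set word n}) (d : nat) : Prop :=
  (exists x y, [/\ x \in C, y \in C, x != y & hamming x y = d]) /\
  (forall x y, x \in C -> y \in C -> x != y -> d <= hamming x y).

Definition preparata n (C : {set word n}) : Prop :=
  (exists m, [/\ 4 <= m, ~~ odd m & n = 2 ^ m]) /\
  code_distance C 6 /\
  (forall C' : {set word n}, code_distance C' 6 -> #|C'| <= #|C|).

(* The minimal distance graphs of C1 and C2 are isomorphic: there is a
   bijection f : C1 -> C2 (given as a function on words, injective on C1 with
   image C2) preserving adjacency, where x,y are adjacent iff their distance
   equals the code distance. *)
Definition min_dist_graph_iso n (C1 C2 : {set word n}) : Prop :=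
  exists d1 d2, code_distance C1 d1 /\ code_distance C2 d2 /\
  exists f : word n -> word n,
    [/\ {in C1 &, injective f}, f @: C1 = C2 &
        {in C1 &, forall x y, (hamming x y == d1) = (hamming (f x) (f y) == d2)}].

Definition isometric n (C1 C2 : {set word n}) : Prop :=
  exists I : word n -> word n,
    (forall x, x \in C1 -> I x \in C2) /\
    {in C1 &, forall x y, hamming (I x) (I y) = hamming x y}.

(* Main.v *)
Require Import Defs.
From mathcomp Require Import all_boot.
From mathcomp Require Import all_algebra all_field zify ring.

(** Call a family of codewords at pairwise distance at least 6 extremal if it has at least
2^n / n^2 members.

Extremality. The code of Baker, van Lint and Wilson over the field with n/2 elements shows
that Preparata codes are extremal.  Conversely, for an even extremal code, the Johnson bound
(counting the codewords at distance 1 and 3 from each odd word) is tight.  Since n = 1 mod 3,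
tightness says that for every codeword a and every triple S all coordinates outside S but one
lie in a distance-6 neighbour block of a containing S; so the 4-sets that lie in no such block
form a Steiner quadruple system.  A code of mixed parity is made even by recomputing one
coordinate of S as a parity bit, which does not affect the blocks through that coordinate.

Reconstruction.  Let w = d(a, b).  At most C(w,3)/4 of the C(w,4) quadruples in the support
of a + b are uncovered, so a neighbour of a can be found closer to b, and all distances are
even.  By induction on w a graph isomorphism preserves the distances below w.  If it moved b
to distance w' > w from a, the neighbours of a whose blocks meet the support in k >= 4 points
would meet the new support in k + (w' - w)/2 <= 6 points, and this would cover more quadruples
than there are. *)

Set Implicit Arguments. Unset Strict Implicit. Unset Printing Implicit Defensive.

Import GRing.Theory.

(** * Words and distances *)

Section Words.
Variable n : nat.
Implicit Types (x y z v : word n) (S : {set 'I_n}).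

Definition diff x y : {set 'I_n} := [set i | x i != y i].
Definition flip x S : word n := [ffun i => x i (+) (i \in S)].
Definition zero_word : word n := [ffun => false].

Lemma hammingE x y : hamming x y = #|diff x y|. Proof. by []. Qed.

Lemma diff_flip x S : diff x (flip x S) = S.
Proof. by apply/setP => i; rewrite !inE ffunE; case: (x i); case: (i \in S). Qed.

Lemma flip_diff x y : flip x (diff x y) = y.
Proof. by apply/ffunP => i; rewrite ffunE inE; case: (x i); case: (y i). Qed.

Lemma flipK S : involutive (flip^~ S).
Proof. by move=> x; apply/ffunP => i; rewrite !ffunE -addbA addbb addbF. Qed.

Lemma diffC x y : diff x y = diff y x.
Proof. by apply/setP => i; rewrite !inE eq_sym. Qed.

Lemma hammingC x y : hamming x y = hamming y x.
Proof. by rewrite !hammingE diffC. Qed.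

Lemma hamming_eq0 x y : (hamming x y == 0) = (x == y).
Proof.
apply/idP/eqP => [|->]; last first.
  by rewrite hammingE cards_eq0; apply/eqP/setP => i; rewrite !inE eqxx.
rewrite hammingE cards_eq0 => /eqP d0; rewrite -(flip_diff x y) d0.
by apply/ffunP => i; rewrite ffunE inE addbF.
Qed.

Lemma hammingxx x : hamming x x = 0.
Proof. by apply/eqP; rewrite hamming_eq0. Qed.

(** [diff y z] is the symmetric difference of [diff x y] and [diff x z]. *)
Lemma hamming_cap x y z :
  hamming y z + 2 * #|diff x y :&: diff x z| = hamming x y + hamming x z.
Proof.
have -> : hamming y z = #|diff x y :\: diff x z| + #|diff x z :\: diff x y|.
  rewrite -cardsUI (_ : _ :&: _ = set0); last first.
    by apply/setP => i; rewrite !inE; case: (x i); case: (y i); case: (z i).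
  rewrite cards0 addn0; apply: eq_card => i; rewrite !inE.
  by case: (x i); case: (y i); case: (z i).
have := cardsID (diff x z) (diff x y); have := cardsID (diff x y) (diff x z).
rewrite [diff x z :&: _]setIC !hammingE; lia.
Qed.

Lemma odd_hamming x y z :
  odd (hamming y z) = odd (hamming x y) (+) odd (hamming x z).
Proof. by rewrite -oddD -(hamming_cap x y z) oddD mul2n odd_double addbF. Qed.

Lemma card_sphere x k : #|[set v | hamming x v == k]| = 'C(n, k).
Proof.
rewrite -[in RHS](card_ord n) -card_draws -(card_imset _ (can_inj (@diff_flip x))).
apply: eq_card => v; rewrite inE; apply/idP/imsetP => [vk | [S]].
  by exists (diff x v); rewrite ?flip_diff // inE.
by rewrite inE => /eqP <- ->; rewrite hammingE diff_flip.
Qed.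

Lemma card_odd_words : 0 < n -> #|[set v | odd (hamming zero_word v)]|.*2 = 2 ^ n.
Proof.
move=> n0; pose i0 := Ordinal n0; pose O := [set v | odd (hamming zero_word v)].
have cE : #|~: O| = #|O|.
  rewrite -(card_imset O (can_inj (flipK [set i0]))).
  have flip_odd v : odd (hamming zero_word (flip v [set i0])) = ~~ odd (hamming zero_word v).
    rewrite (odd_hamming v) hammingC [hamming v _]hammingE diff_flip cards1.
    by rewrite addbT.
  apply: eq_card => v; rewrite !inE; apply/idP/imsetP => [ev | [w]].
    by exists (flip v [set i0]); rewrite ?flipK // inE flip_odd.
  by rewrite inE => ow ->; rewrite flip_odd ow.
have := cardsC O; rewrite cE -addnn => ->.
by rewrite card_ffun card_bool card_ord.
Qed.

End Words.

(** Indexed families rather than sets: two codes with isomorphic graphs then share one index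
    type. *)
Definition separated n (I : finType) (u : I -> word n) : Prop :=
  forall a b, a != b -> 6 <= hamming (u a) (u b).

(* Among the 4-sets containing [S], at most one lies in no block [diff (u a) (u b)] of size 6. *)
Definition covering n (I : finType) (u : I -> word n) : Prop :=
  forall a (S : {set 'I_n}) j k, #|S| = 3 -> j \notin S -> k \notin S -> j != k ->
  exists b, [/\ hamming (u a) (u b) = 6, S \subset diff (u a) (u b) &
                (j \in diff (u a) (u b)) || (k \in diff (u a) (u b))].

(** * Tightness of the Johnson bound *)

Section Johnson.
Variables (n : nat) (I : finType) (u : I -> word n).
Hypothesis usep : separated u.
Implicit Types (v : word n) (a b : I).

Let near (k : nat) v := [set a | hamming v (u a) == k].
Let reach v := \bigcup_(a in near 3 v) diff v (u a).

(** By [hamming_cap] the two distances add up to at least 6 plus twice the overlap of the difference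
    sets. *)
Lemma near_disjoint v a b : a != b -> hamming v (u a) + hamming v (u b) <= 6 ->
  hamming v (u a) + hamming v (u b) = 6 /\ diff v (u a) :&: diff v (u b) = set0.
Proof.
move=> /usep dab le6; have := hamming_cap v (u a) (u b) => e.
split; first lia.
apply/eqP; rewrite -cards_eq0; lia.
Qed.

Lemma card_near3 v : 3 * #|near 3 v| <= #|reach v|.
Proof.
rewrite mulnC -sum_nat_const.
have -> : \sum_(a in near 3 v) 3 = \sum_(a in near 3 v) \sum_(i in diff v (u a)) 1.
  by apply: eq_bigr => a; rewrite inE sum1_card => /eqP.
rewrite (exchange_big_dep (mem (reach v))) /=; last first.
  by move=> a i an ia; apply/bigcupP; exists a.
rewrite -[leqRHS]sum1_card; apply: leq_sum => i _.
rewrite sum1dep_card leqNgt; apply/negP => /card_gt1P [a [b [+ + ab]]].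
rewrite !inE => /andP [/eqP a3 ia] /andP [/eqP b3 ib].
have [] := near_disjoint (v := v) ab; first by rewrite a3 b3.
by move=> _ /setP /(_ i); rewrite !inE ia ib.
Qed.

Hypotheses (n_mod3 : n %% 3 = 1).

(* [n.-1 %/ 3] is the largest number of pairwise disjoint triples since [n = 1 %[mod 3]]. *)
Lemma johnson_local v : n.-1 * #|near 1 v| + 3 * #|near 3 v| <= n.-1.
Proof.
have [n1|] := posnP #|near 1 v|.
  have := card_near3 v; have := subset_leq_card (subsetT (reach v)).
  rewrite cardsT card_ord n1 muln0 add0n => le1 le2; lia.
move=> /card_gt0P [a]; rewrite inE => /eqP a1.
have n1 : #|near 1 v| <= 1.
  rewrite leqNgt; apply/negP => /card_gt1P [b [c [+ + bc]]].
  rewrite !inE => /eqP b1 /eqP c1.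
  by have [] := near_disjoint (v := v) bc; rewrite b1 c1.
have -> : near 3 v = set0.
  apply/setP => b; rewrite !inE; apply/negP => /eqP b3.
  have ab : a != b by apply/eqP => e; move: a1; rewrite e b3.
  by have [] := near_disjoint (v := v) ab; rewrite a1 b3.
by rewrite cards0 muln0 addn0 -{2}[n.-1]muln1 leq_mul2l n1 orbT.
Qed.

Hypothesis (u_even : forall a, ~~ odd (hamming (zero_word n) (u a))).
Hypothesis (u_large : 2 ^ n <= n ^ 2 * #|I|).

(** Double counting of pairs at distance [k]: words at odd distance from an even codeword are all
    odd. *)
Lemma sum_near k : odd k ->
  \sum_(v : word n | odd (hamming (zero_word n) v)) #|near k v| = #|I| * 'C(n, k).
Proof.
move=> ok.
under eq_bigr => v _ do rewrite -sum1_card.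
rewrite (exchange_big_dep predT) //= -sum_nat_const; apply: eq_bigr => a _.
rewrite sum1dep_card -(card_sphere (u a) k); apply: eq_card => v; rewrite !inE [hamming (u a) v]hammingC.
case: eqP => [e|_]; rewrite ?andbF // ?andbT.
by rewrite (odd_hamming (u a)) [hamming (u a) v]hammingC e ok hammingC (negPf (u_even a)).
Qed.

(** Summed over the 2^(n-1) odd words, the two sides of [johnson_local] become |I| n^2 (n-1) / 2 and
    2^(n-1) (n-1). By [u_large] the first is at least the second, so no summand is strict. *)
Lemma johnson_equality v : odd (hamming (zero_word n) v) ->
  n.-1 * #|near 1 v| + 3 * #|near 3 v| = n.-1.
Proof.
move=> ov.
have n0 : 0 < n by lia.
have eqif := @leqif_sum _ [pred v | odd (hamming (zero_word n) v)] _ _ _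
  (fun v _ => leqif_eq (johnson_local v)).
suff: [forall (v | odd (hamming (zero_word n) v)),
         n.-1 * #|near 1 v| + 3 * #|near 3 v| == n.-1].
  by move/forall_inP => /(_ v ov) /eqP.
rewrite -(geq_leqif eqif) big_split -!big_distrr /= !sum_near // sum_nat_const.
rewrite -leq_double doubleMl -cardsE card_odd_words //.
apply: leq_trans (leq_mul u_large (leqnn _)) _.
have c3 : 6 * 'C(n, 3) = n * n.-1 * n.-2.
  by have := bin_ffact n 3; rewrite !ffactnS ffactn0 /= /factorial; lia.
rewrite bin1; case: (n) n0 c3 => [//|[|p]] _ /= c3; nia.
Qed.

(** Flipping [S] in [u a] gives an odd word at distance 3 from [u a], hence with no codeword at
    distance 1. By tightness the disjoint triples around it miss at most one coordinate, and each
    triple other than [S] forms with [S] a block of [a]. *)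
Lemma johnson_covering : covering u.
Proof.
move=> a S j k S3 jS kS jk; pose v := flip (u a) S.
have dav : diff v (u a) = S by rewrite diffC diff_flip.
have av : hamming v (u a) = 3 by rewrite hammingE dav.
have ov : odd (hamming (zero_word n) v).
  by rewrite (odd_hamming (u a)) hammingC (negPf (u_even a)) hammingC av.
have an3 : a \in near 3 v by rewrite inE av.
have := johnson_equality ov; have n1 : #|near 1 v| = 0.
  apply/eqP; rewrite cards_eq0; apply/eqP/setP => b; rewrite !inE; apply/negP => /eqP b1.
  have ab : a != b by apply/eqP => e; move: b1; rewrite -e av.
  by have [] := near_disjoint (v := v) ab; rewrite b1 av.
rewrite n1 muln0 add0n => n3.
suff : (j \in reach v) || (k \in reach v).
  have main i : i \notin S -> i \in reach v ->
    exists b, [/\ hamming (u a) (u b) = 6, S \subset diff (u a) (u b) & i \in diff (u a) (u b)].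
    move=> iS /bigcupP [b]; rewrite inE => /eqP b3 ib.
    have ab : a != b by apply/eqP => e; move: ib; rewrite -e dav (negPf iS).
    have [] := near_disjoint (v := v) ab; first by rewrite b3 av.
    move=> _ e0; have ecap := hamming_cap v (u a) (u b).
    exists b; split.
    - by move: ecap; rewrite e0 cards0 av b3; lia.
    - apply/subsetP => s; rewrite -dav => sS; move/setP: e0 => /(_ s).
      by move: sS; rewrite !inE; case: (v s); case: (u a s); case: (u b s).
    - by move: iS ib; rewrite -dav !inE; case: (v i); case: (u a i); case: (u b i).
  by case/orP => [/(main _ jS)|/(main _ kS)] [b [? ? h]]; exists b; rewrite h ?orbT.
apply: contraT; rewrite negb_or => /andP [jR kR].
have : reach v \subset [set: 'I_n] :\ j :\ k.
  apply/subsetP => i iR; rewrite !inE andbT; apply/andP; split.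
    by apply: contraNneq kR => <-.
  by apply: contraNneq jR => <-.
move/subset_leq_card; have := card_near3 v.
have := cardsD1 j [set: 'I_n]; have := cardsD1 k ([set: 'I_n] :\ j).
rewrite !inE eq_sym jk /= cardsT card_ord; lia.
Qed.

End Johnson.

(** * Reduction to even codes *)

Section Parity.
Variables (n : nat) (i : 'I_n).
Implicit Types x y : word n.

Definition fix_parity x : word n :=
  flip x (if odd (hamming (zero_word n) x) then [set i] else set0).

Lemma fix_parity_even x : ~~ odd (hamming (zero_word n) (fix_parity x)).
Proof.
rewrite (odd_hamming x) [hamming x (fix_parity x)]hammingE diff_flip [hamming x _]hammingC.
by case: (odd _); rewrite ?cards1 ?cards0.
Qed.

Lemma diff_fix_parity x y :
  diff (fix_parity x) (fix_parity y) :\ i = diff x y :\ i.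
Proof.
apply/setP => j; rewrite !inE; have [//|/negPf ji] := eqVneq j i.
by rewrite !ffunE; do 2 case: ifP => _; rewrite !inE ?ji ?addbF.
Qed.

Variables (I : finType) (u : I -> word n).
Hypothesis usep : separated u.

(** At least five differences lie outside [i], and an even number above 4 is at least 6. *)
Lemma fix_parity_separated : separated (fun a => fix_parity (u a)).
Proof.
move=> a b /usep; rewrite hammingE (cardsD1 i) -diff_fix_parity.
set D := diff (fix_parity _) (fix_parity _) => h.
have ev : ~~ odd #|D|.
  by rewrite -hammingE (odd_hamming (zero_word n)) !(negPf (fix_parity_even _)).
rewrite hammingE -/D; have := cardsD1 i D.
move: h ev; move: #|D :\ i| #|D| => p q; case: (i \in diff _ _); case: (i \in D) => /=; lia.
Qed.

(** Exactly five differences lie outside [i], so the original distance, being at least 6, must use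
    [i] too. *)
Lemma diff_fix_parity6 a b : hamming (fix_parity (u a)) (fix_parity (u b)) = 6 ->
  i \in diff (fix_parity (u a)) (fix_parity (u b)) ->
  diff (u a) (u b) = diff (fix_parity (u a)) (fix_parity (u b)).
Proof.
move=> d6 iD; have ab : a != b by apply: contra_eq_neq d6 => ->; rewrite hammingxx.
move: d6; rewrite hammingE (cardsD1 i) iD diff_fix_parity => d6.
have := usep ab; rewrite hammingE (cardsD1 i) => h.
have iD' : i \in diff (u a) (u b) by move: h d6; move: #|_ :\ _| => q; case: (i \in _) => //=; lia.
by rewrite -(setD1K iD) diff_fix_parity setD1K.
Qed.

End Parity.

Lemma separated_covering n (I : finType) (u : I -> word n) :
  separated u -> n %% 3 = 1 -> 2 ^ n <= n ^ 2 * #|I| -> covering u.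
Proof.
move=> usep n3 large a S j k S3 jS kS jk.
(* A parity coordinate inside [S] lies in every block through [S], so [diff_fix_parity6] applies to
   these blocks. *)
have /card_gt0P [i iS] : 0 < #|S| by rewrite S3.
have [b [d6 SD jkD]] := johnson_covering (fix_parity_separated i usep) n3
  (fun a => fix_parity_even i (u a)) large a S3 jS kS jk.
have e := diff_fix_parity6 usep d6 (subsetP SD i iS).
by exists b; rewrite hammingE e.
Qed.

(** * Covered quadruples *)

Section Quadruples.
Variables (n : nat) (I : finType) (u : I -> word n).
Hypotheses (usep : separated u) (ucov : covering u).
Implicit Types (a b z : I) (S T : {set 'I_n}).

(** By [card_blocks] this is the number of covered quadruples in [diff (u a) (u b)]. Written through
    intersection sizes, it can be compared between two codes block by block. *)
Definition quad_count a b :=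
  \sum_(z | hamming (u a) (u z) == 6) 'C(#|diff (u a) (u z) :&: diff (u a) (u b)|, 4).

Let blocks a T := [set z | (hamming (u a) (u z) == 6) && (T \subset diff (u a) (u z))].

Lemma quad_countE a b :
  quad_count a b = \sum_(T : {set 'I_n} | (T \subset diff (u a) (u b)) && (#|T| == 4)) #|blocks a T|.
Proof.
transitivity (\sum_(z | hamming (u a) (u z) == 6)
  \sum_(T : {set 'I_n} | (T \subset diff (u a) (u z) :&: diff (u a) (u b)) && (#|T| == 4)) 1).
  apply: eq_bigr => z _; rewrite sum1dep_card -cards_draws.
  by apply: eq_card => T; rewrite !inE.
rewrite (exchange_big_dep
  (fun T : {set 'I_n} => (T \subset diff (u a) (u b)) && (#|T| == 4))) /=; last first.
  by move=> z T _; rewrite subsetI -andbA => /andP [_].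
apply: eq_bigr => T /andP [TY T4]; rewrite sum1dep_card; apply: eq_card => z.
by rewrite !inE subsetI TY T4 !andbT.
Qed.

Lemma card_blocks a T : #|T| = 4 -> #|blocks a T| <= 1.
Proof.
move=> T4; rewrite leqNgt; apply/negP => /card_gt1P [y [z [+ + yz]]].
rewrite !inE => /andP [/eqP y6 Ty] /andP [/eqP z6 Tz].
have := hamming_cap (u a) (u y) (u z); have := usep yz.
have : #|T| <= #|diff (u a) (u y) :&: diff (u a) (u z)|.
  by apply: subset_leq_card; rewrite subsetI Ty.
lia.
Qed.

Lemma quad_count_le a b : quad_count a b <= 'C(hamming (u a) (u b), 4).
Proof.
rewrite quad_countE hammingE -cards_draws -sum1dep_card.
by apply: leq_sum => T /andP [_ /eqP /card_blocks].
Qed.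

Let uncovered a b := [set T : {set 'I_n} |
  [&& T \subset diff (u a) (u b), #|T| == 4 & blocks a T == set0]].

Lemma uncovered_extension_unique a b S : #|S| = 3 ->
  #|[set T in uncovered a b | S \subset T]| <= 1.
Proof.
move=> S3; rewrite leqNgt; apply/negP => /card_gt1P [T [T' [+ + TT']]].
have ext Q : Q \in [set T in uncovered a b | S \subset T] ->
    exists2 j, j \notin S & Q = j |: S /\ blocks a Q = set0.
  rewrite !inE => /andP [/and3P [_ /eqP Q4 /eqP Q0] SQ].
  have /cards1P [j Qj] : #|Q :\: S| == 1 by rewrite cardsDS // Q4 S3.
  have : j \in Q :\: S by rewrite Qj set11.
  rewrite inE => /andP [jS _]; exists j => //; split => //.
  by rewrite -{1}(setID Q S) (setIidPr SQ) Qj setUC.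
move=> /ext [j jS [Tj T0]] /ext [k kS [T'k T'0]].
have jk : j != k by apply: contraNneq TT' => e; rewrite Tj T'k e.
have [z [z6 Sz /orP [jz|kz]]] := ucov a S3 jS kS jk.
- by move/setP: T0 => /(_ z); rewrite !inE z6 Tj subUset sub1set jz Sz.
- by move/setP: T'0 => /(_ z); rewrite !inE z6 T'k subUset sub1set kz Sz.
Qed.

(** Each quadruple contains four triples, and no triple lies in two uncovered quadruples. *)
Lemma card_uncovered a b : 4 * #|uncovered a b| <= 'C(hamming (u a) (u b), 3).
Proof.
rewrite mulnC -sum_nat_const.
have -> : \sum_(T in uncovered a b) 4 =
    \sum_(T in uncovered a b) \sum_(S : {set 'I_n} | (S \subset T) && (#|S| == 3)) 1.
  apply: eq_bigr => T; rewrite inE => /and3P [_ /eqP T4 _].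
  by rewrite sum1dep_card cards_draws T4.
rewrite (exchange_big_dep
  (fun S : {set 'I_n} => (S \subset diff (u a) (u b)) && (#|S| == 3))) /=; last first.
  move=> T S; rewrite inE => /andP [TY _] /andP [ST ->].
  by rewrite (subset_trans ST TY).
rewrite hammingE -cards_draws -[leqRHS]sum1dep_card; apply: leq_sum => S /andP [_ S3].
rewrite sum1dep_card; apply: leq_trans (uncovered_extension_unique a b (eqP S3)).
by apply: subset_leq_card; apply/subsetP => T; rewrite !inE S3 andbT.
Qed.

(** Of 4 C(w,4) = (w-3) C(w,3), at most C(w,3) is lost to uncovered quadruples. *)
Lemma quad_count_ge a b :
  'C(hamming (u a) (u b), 3) * (hamming (u a) (u b) - 4) <= 4 * quad_count a b.
Proof.
set w := hamming _ _.
have : 'C(w, 4) <= quad_count a b + #|uncovered a b|.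
  rewrite quad_countE /w hammingE -cards_draws -sum1dep_card.
  rewrite [#|uncovered a b|](_ : _ =
    \sum_(T : {set 'I_n} | (T \subset diff (u a) (u b)) && (#|T| == 4)) (blocks a T == set0)).
    rewrite -big_split; apply: leq_sum => T _ /=.
    by rewrite -cards_eq0; case: (#|_|).
  rewrite -big_mkcondr sum1dep_card; apply: eq_card => T; rewrite !inE.
  by rewrite andbA.
have := card_uncovered a b; have := mul_bin_left w 3; rewrite -/w; nia.
Qed.

Lemma hamming_block a b z : hamming (u a) (u z) = 6 ->
  hamming (u z) (u b) + 2 * #|diff (u a) (u z) :&: diff (u a) (u b)| =
  6 + hamming (u a) (u b).
Proof. by move=> z6; rewrite hamming_cap z6. Qed.

(** Descent: for [a != b] the distance is at least 6, so [quad_count_ge] yields a block with k >= 4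
    points in the support. Passing to its codeword lowers the distance by 2k - 6, which is even and
    positive. *)
Lemma separated_even a b : ~~ odd (hamming (u a) (u b)).
Proof.
have [w] := ubnP (hamming (u a) (u b)); elim: w => // w IH in a *; rewrite ltnS => le_w.
have [->|ab] := eqVneq a b; first by rewrite hammingxx.
have /usep ge6 := ab.
have : 0 < quad_count a b.
  have := quad_count_ge a b; have : 0 < 'C(hamming (u a) (u b), 3) by rewrite bin_gt0; lia.
  nia.
rewrite lt0n sum_nat_eq0 negb_forall => /existsP [z].
rewrite negb_imply -lt0n bin_gt0 => /andP [/eqP z6 cap4].
have := hamming_block b z6 => e.
have := IH z; lia.
Qed.

End Quadruples.

(** * Reconstruction of the distances *)

Lemma bin3E w : 6 * 'C(w, 3) = w * (w - 1) * (w - 2).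
Proof.
have := mul_bin_left w 2; have := mul_bin_left w 1; rewrite bin1 => e1 e2.
by rewrite -[6]/(2 * 3) -mulnA e2 mulnCA e1; lia.
Qed.

Lemma bin4E w : 24 * 'C(w, 4) = w * (w - 1) * (w - 2) * (w - 3).
Proof. by rewrite -bin3E -[24]/(6 * 4) -mulnA (mul_bin_left w 3); lia. Qed.

(** The factor 3 is C(6,4) / C(5,4). The bound fails at w = 8, which [hamming_step] treats apart. *)
Lemma bin_gap2 w : 10 <= w -> 4 * 'C(w.+2, 4) < 3 * ('C(w, 3) * (w - 4)).
Proof.
move=> w10; rewrite -(ltn_pmul2l (isT : 0 < 6)) mulnA bin4E.
have -> : 6 * (3 * ('C(w, 3) * (w - 4))) = 3 * (6 * 'C(w, 3)) * (w - 4) by lia.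
rewrite bin3E; have := subnKC w10; move: (w - 10) => t <-.
have -> : (10 + t).+2 - 1 = 11 + t by lia.
have -> : (10 + t).+2 - 2 = 10 + t by lia.
have -> : (10 + t).+2 - 3 = 9 + t by lia.
have -> : 10 + t - 1 = 9 + t by lia.
have -> : 10 + t - 2 = 8 + t by lia.
have -> : 10 + t - 4 = 6 + t by lia.
have lt : (12 + t) * (11 + t) < 3 * (8 + t) * (6 + t) by nia.
have -> : (10 + t).+2 * (11 + t) * (10 + t) * (9 + t) =
    (10 + t) * (9 + t) * ((12 + t) * (11 + t)) by lia.
have -> : 3 * ((10 + t) * (9 + t) * (8 + t)) * (6 + t) =
    (10 + t) * (9 + t) * (3 * (8 + t) * (6 + t)) by lia.
by rewrite ltn_pmul2l.
Qed.

(** The factor 15 is C(6,4) / C(4,4). *)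
Lemma bin_gap4 w : 8 <= w -> 4 * 'C(w.+4, 4) < 15 * ('C(w, 3) * (w - 4)).
Proof.
move=> w8; rewrite -(ltn_pmul2l (isT : 0 < 6)) mulnA bin4E.
have -> : 6 * (15 * ('C(w, 3) * (w - 4))) = 15 * (6 * 'C(w, 3)) * (w - 4) by lia.
rewrite bin3E; have := subnKC w8; move: (w - 8) => t <-.
have -> : (8 + t).+4 - 1 = 11 + t by lia.
have -> : (8 + t).+4 - 2 = 10 + t by lia.
have -> : (8 + t).+4 - 3 = 9 + t by lia.
have -> : 8 + t - 1 = 7 + t by lia.
have -> : 8 + t - 2 = 6 + t by lia.
have -> : 8 + t - 4 = 4 + t by lia.
have lt1 : (8 + t).+4 * (9 + t) < 4 * ((8 + t) * (4 + t)) by nia.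
have lt2 : 2 * ((11 + t) * (10 + t)) < 6 * ((7 + t) * (6 + t)) by nia.
(* Halving the product of [lt1] and [lt2] gives the bound even with 12 in place of 15. *)
have := ltn_mul lt1 lt2; nia.
Qed.

Section DistanceStep.
Variables (n : nat) (I : finType) (u v : I -> word n).
Hypotheses (usep : separated u) (ucov : covering u).
Hypotheses (vsep : separated v) (vcov : covering v).
Hypothesis adj : forall a b, (hamming (u a) (u b) == 6) = (hamming (v a) (v b) == 6).
Variable w : nat.
Hypothesis closer : forall a b, hamming (u a) (u b) < w ->
  hamming (v a) (v b) = hamming (u a) (u b).
Hypothesis closer' : forall a b, hamming (v a) (v b) < w ->
  hamming (u a) (u b) = hamming (v a) (v b).

Lemma quad_count_ratio q a b :
  (forall z, hamming (u a) (u z) = 6 ->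
    4 <= #|diff (u a) (u z) :&: diff (u a) (u b)| ->
    q * 'C(#|diff (u a) (u z) :&: diff (u a) (u b)|, 4) <=
    'C(#|diff (v a) (v z) :&: diff (v a) (v b)|, 4)) ->
  q * quad_count u a b <= quad_count v a b.
Proof.
move=> le_q; rewrite /quad_count big_distrr /= [leqRHS](eq_bigl _ _ (fun z => esym (adj a z))).
apply: leq_sum => z /eqP z6; have [lt4|ge4] := ltnP #|diff (u a) (u z) :&: diff (u a) (u b)| 4.
  by rewrite bin_small // muln0.
exact: le_q.
Qed.

(* A block meeting [diff (u a) (u b)] in at least four points leads to a codeword closer
   to [b], whose distance to [b] is therefore preserved; so if [b] were farther from [a]
   on the side of [v], the intersection would be larger there, up to the block size 6. *)
Lemma cap_shift a b z : hamming (u a) (u b) = w -> hamming (u a) (u z) = 6 ->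
  4 <= #|diff (u a) (u z) :&: diff (u a) (u b)| ->
  2 * #|diff (v a) (v z) :&: diff (v a) (v b)| + w =
    2 * #|diff (u a) (u z) :&: diff (u a) (u b)| + hamming (v a) (v b) /\
  #|diff (v a) (v z) :&: diff (v a) (v b)| <= 6.
Proof.
move=> abw z6 cap4; have z6' : hamming (v a) (v z) = 6 by apply/eqP; rewrite -adj z6.
split; last by rewrite -[leqRHS]z6' hammingE subset_leq_card ?subsetIl.
have e := hamming_block b z6; have e' := hamming_block b z6'.
have /closer zb : hamming (u z) (u b) < w by lia.
lia.
Qed.

Lemma hamming_step a b : hamming (u a) (u b) = w -> hamming (v a) (v b) = w.
Proof.
move=> abw; have [eab|ab] := eqVneq a b.
  by rewrite -abw eab !hammingxx.
have w6 : 6 <= w by rewrite -abw usep.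
have [ew|w7] : w = 6 \/ 6 < w by lia.
  by apply/eqP; rewrite ew -adj abw ew.
have ew : ~~ odd w by rewrite -abw separated_even.
have ew' := separated_even vsep vcov a b.
have shift := cap_shift abw.
have lo := quad_count_ge ucov a b; have hi := quad_count_le vsep a b.
have := @quad_count_ratio _ a b; have := closer' (a := a) (b := b).
rewrite abw in lo *; move: hi ew' shift; move: (hamming (v a) (v b)) => w' hi ew' shift low ratio.
have [lt|] := ltnP w' w; first by have := low lt; lia.
rewrite leq_eqVlt => /orP [/eqP //|gt]; exfalso.
(* Both distances are even. Intersections of at least 4 points grow by half the gap and stay within
   6: a gap of 2 multiplies the quadruples of a block by 5 or 3, a gap of 4 by 15, and a larger gap
   allows no such block at all. *)
have [e|[e|gt6]] : w' = w.+2 \/ w' = w.+4 \/ w + 6 <= w' by lia.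
- have [e8|w10] : w = 8 \/ 10 <= w by lia.
    have : 5 * quad_count u a b <= quad_count v a b.
      apply: ratio => z z6 k4; have [] := shift z z6 k4.
      (* [k = 5] would put [z] at distance 4 from [b]. *)
      have zb : z != b by apply: contra_eq_neq abw => <-; rewrite z6; lia.
      have := hamming_block b z6; have := usep zb; rewrite abw.
      move: #|_| #|_| k4 => k' k k4 h1 h2 h3 h4.
      have -> : k = 4 by lia.
      by have -> : k' = 5 by lia.
    move: lo hi; rewrite e e8 (_ : 'C(8, 3) * (8 - 4) = 224) // (_ : 'C(10, 4) = 210) //.
    lia.
  have : 3 * quad_count u a b <= quad_count v a b.
    apply: ratio => z z6 k4; have [] := shift z z6 k4.
    move: #|_| #|_| k4 => k' k k4 h1 h2.
    have -> : k' = k.+1 by lia.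
    by have [->|->] : k = 4 \/ k = 5 by lia.
  have := bin_gap2 w10; rewrite -e; lia.
- have : 15 * quad_count u a b <= quad_count v a b.
    apply: ratio => z z6 k4; have [] := shift z z6 k4.
    move: #|_| #|_| k4 => k' k k4 h1 h2.
    have -> : k = 4 by lia.
    by have -> : k' = 6 by lia.
  have /bin_gap4 : 8 <= w by lia.
  rewrite -e; lia.
- suff : quad_count u a b = 0.
    have : 0 < 'C(w, 3) by rewrite bin_gt0; lia.
    by nia.
  apply/eqP; rewrite sum_nat_eq0; apply/forall_inP => z /eqP z6.
  rewrite -leqn0 leqNgt bin_gt0; apply/negP => k4; have [] := shift z z6 k4.
  lia.
Qed.

End DistanceStep.

(** Both directions advance together, since [hamming_step] assumes that shorter distances in either
    code are preserved. *)
Lemma min_dist_graph_iso_isometry n (I : finType) (u v : I -> word n) :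
  separated u -> covering u -> separated v -> covering v ->
  (forall a b, (hamming (u a) (u b) == 6) = (hamming (v a) (v b) == 6)) ->
  forall a b, hamming (v a) (v b) = hamming (u a) (u b).
Proof.
move=> usep ucov vsep vcov adj.
suff main w : (forall a b, hamming (u a) (u b) < w -> hamming (v a) (v b) = hamming (u a) (u b))
  /\ (forall a b, hamming (v a) (v b) < w -> hamming (u a) (u b) = hamming (v a) (v b)).
  by move=> a b; case: (main (hamming (u a) (u b)).+1) => + _; apply.
elim: w => [|w [IHu IHv]]; first by split.
split => a b; rewrite ltnS leq_eqVlt => /orP [/eqP abw|]; [|exact: IHu| |exact: IHv].
  by rewrite abw; apply: (hamming_step usep ucov vsep vcov adj IHu IHv).
by rewrite abw; apply: (hamming_step vsep vcov usep ucov _ IHv IHu).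
Qed.

(** * The Baker-van Lint-Wilson construction *)

Lemma large_fiber (T U : finType) (f : T -> U) (x0 : T) :
  exists t, #|T| <= #|U| * #|[set x | f x == t]|.
Proof.
have [t _ tmax] := @arg_maxnP U (f x0) predT (fun t => #|[set x | f x == t]|) isT.
exists t; rewrite -sum_nat_const -[leqLHS]sum1_card (partition_big f (mem U)) //=.
apply: leq_sum => s _; apply: leq_trans (tmax s isT).
by rewrite sum1dep_card subset_leq_card //; apply/subsetP => x; rewrite !inE.
Qed.

(** * Power sums in characteristic two *)

Section CharTwo.
Variable F : finFieldType.
Hypothesis two0 : (2%:R = 0 :> F)%R.
Local Open Scope ring_scope.

Lemma addr_self (x : F) : x + x = 0.
Proof. by rewrite -mulr2n -mulr_natr two0 mulr0. Qed.

Lemma oppr_self (x : F) : - x = x.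
Proof. by apply/eqP; rewrite eq_sym -addr_eq0 addr_self. Qed.

Lemma addr_eq0_self (x y : F) : (x + y == 0) = (x == y).
Proof. by rewrite addr_eq0 oppr_self. Qed.

Lemma natr_odd k : k%:R = (odd k)%:R :> F.
Proof. by rewrite -{1}(odd_double_half k) natrD -muln2 natrM two0 mulr0 addr0. Qed.

Lemma natr_eq0_odd k : (k%:R == 0 :> F) = ~~ odd k.
Proof. by rewrite natr_odd; case: odd; rewrite ?oner_eq0 ?eqxx. Qed.

Variables (I : finType) (g : I -> F) (A : {set I}).
Hypothesis g_inj : {in A &, injective g}.

Lemma power_sums2 : #|A| = 2 -> exists a s, [/\ s != 0, \sum_(i in A) g i = s
  & \sum_(i in A) g i ^+ 3 = a ^+ 2 * s + a * s ^+ 2 + s ^+ 3].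
Proof.
move=> /eqP /cards2P [i [j [ij eA]]]; exists (g i), (g i + g j).
rewrite eA !big_setU1 ?inE //= !big_set1; split => //.
  rewrite addr_eq0_self; apply: contra_neq ij => /g_inj; apply; by rewrite eA !inE eqxx ?orbT.
(* [ring] ignores the characteristic, so the terms that vanish are kept as an explicit multiple of
   2. *)
have -> : g i ^+ 3 + g j ^+ 3 =
    g i ^+ 2 * (g i + g j) + g i * (g i + g j) ^+ 2 + (g i + g j) ^+ 3
    - 2%:R * (g i ^+ 3 + 3%:R * g i ^+ 2 * g j + 2%:R * g i * g j ^+ 2) by ring.
by rewrite two0 mul0r subr0.
Qed.

(** If x + y + z + t = 0 in characteristic 2, the sum of the cubes is (x+y)(y+z)(z+x), with nonzero
    factors by injectivity. *)
Lemma power_sums4 : #|A| = 4 -> \sum_(i in A) g i = 0 -> \sum_(i in A) g i ^+ 3 != 0.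
Proof.
move=> A4; have /card_gt0P [i iA] : (0 < #|A|)%N by rewrite A4.
have := cardsD1 i A; rewrite iA A4 add1n => -[A3].
have /card_gt0P [j jA] : (0 < #|A :\ i|)%N by rewrite -A3.
have := cardsD1 j (A :\ i); rewrite jA -A3 add1n => -[/esym /eqP /cards2P [k [l [kl eA]]]].
have kA : k \in A :\ i :\ j by rewrite eA !inE eqxx.
have lA : l \in A :\ i :\ j by rewrite eA !inE eqxx orbT.
rewrite -(setD1K iA) -(setD1K jA) eA.
move: jA kA lA; rewrite !inE => /andP [ji jA] /and3P [kj ki kA] /and3P [lj li lA].
rewrite !big_setU1 ?inE ?negb_or ?(eq_sym i j) ?(eq_sym i k) ?(eq_sym i l) ?(eq_sym j k) ?(eq_sym j l) ?ji ?kj ?ki ?lj ?li ?kl //=.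
rewrite !big_set1 => sum0.
have -> : g l = - (g i + g j + g k) by apply/eqP; rewrite -addr_eq0 -sum0; apply/eqP; ring.
have -> : g i ^+ 3 + (g j ^+ 3 + (g k ^+ 3 + (- (g i + g j + g k)) ^+ 3)) =
  - (3%:R * ((g i + g j) * (g j + g k) * (g k + g i))) by ring.
rewrite natr_odd mul1r oppr_eq0 !mulf_eq0 !addr_eq0_self !negb_or.
apply/andP; split; first (apply/andP; split).
- by apply: contra_neq ji => /(g_inj iA jA).
- by apply: contra_neq kj => /(g_inj jA kA).
- by apply: contra_neq ki => /(g_inj kA iA).
Qed.

End CharTwo.

(** * The code and its minimum distance *)

Section Construction.
Variables (F : finFieldType) (n : nat) (e : 'I_n -> bool * F).
Hypotheses (two0 : (2%:R = 0 :> F)%R) (cube_inj : injective (fun x : F => x ^+ 3)%R).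
Hypothesis e_inj : injective e.
Local Open Scope ring_scope.

Definition side (b : bool) (D : {set 'I_n}) := [set i in D | (e i).1 == b].
(** Exponent 0 records the size of the side modulo 2, as an element of [F]. *)
Definition power_sum b k D : F := \sum_(i in side b D) (e i).2 ^+ k.
Definition support (x : word n) := [set i | x i].

(* The Baker-van Lint-Wilson code is the zero fibre, but all fibres have distance 6: the
   condition on two words of a fibre does not involve the common value.  Hence a fibre of at
   least average size can be found by the pigeonhole principle. *)
Definition syndrome (x : word n) : bool * bool * F * F :=
  (power_sum true 0 (support x) != 0, power_sum false 0 (support x) != 0,
   power_sum true 1 (support x) + power_sum false 1 (support x),
   power_sum true 3 (support x) + power_sum false 3 (support x)
     + power_sum true 1 (support x) ^+ 3).

Lemma power_sum_support b k x y :
  power_sum b k (support y) = power_sum b k (support x) + power_sum b k (diff x y).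
Proof.
have E (D : {set 'I_n}) : power_sum b k D =
    \sum_i (if (i \in D) && ((e i).1 == b) then (e i).2 ^+ k else 0).
  by rewrite -big_mkcond; apply: eq_bigl => i; rewrite inE.
rewrite !E -big_split; apply: eq_bigr => i _; rewrite !inE.
by case: (x i); case: (y i); case: (_ == b); rewrite /= ?addr0 ?add0r ?(addr_self two0).
Qed.

Lemma power_sum0 b D : power_sum b 0 D = #|side b D|%:R.
Proof. by rewrite /power_sum -sum1_card natr_sum; apply: eq_bigr => i _; rewrite expr0. Qed.

Lemma side_parity b x y :
  (power_sum b 0 (support x) != 0) = (power_sum b 0 (support y) != 0) ->
  ~~ odd #|side b (diff x y)|.
Proof.
rewrite -(natr_eq0_odd two0) -power_sum0 (power_sum_support b 0 x y).
rewrite !power_sum0 -natrD !(natr_eq0_odd two0) oddD.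
by case: odd; case: odd.
Qed.

Lemma side_inj b D : {in side b D &, injective (fun i => (e i).2)}.
Proof.
move=> i j; rewrite !inE => /andP [_ /eqP ib] /andP [_ /eqP jb] eij.
by apply: e_inj; rewrite [e i]surjective_pairing [e j]surjective_pairing ib jb eij.
Qed.

Lemma card_side D : (#|side true D| + #|side false D|)%N = #|D|.
Proof.
rewrite -(cardsID [set i | (e i).1] D); congr (_ + _)%N; apply: eq_card => i; rewrite !inE.
  by rewrite eqb_id.
by rewrite eqbF_neg andbC.
Qed.

(* [t^2 + t s + s^2] divides [t^3 - s^3]. *)
Lemma no_norm_root (s t : F) : t ^+ 2 + t * s + s ^+ 2 = 0 -> s = 0.
Proof.
move=> ts0; have /cube_inj ets : t ^+ 3 = s ^+ 3.
  apply/eqP; rewrite -subr_eq0.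
  have -> : t ^+ 3 - s ^+ 3 = (t - s) * (t ^+ 2 + t * s + s ^+ 2) by ring.
  by rewrite ts0 mulr0.
move: ts0; rewrite ets.
have -> : s ^+ 2 + s * s + s ^+ 2 = s ^+ 2 + 2%:R * s ^+ 2 by ring.
by rewrite two0 mul0r addr0 => /eqP; rewrite sqrf_eq0 => /eqP.
Qed.

(** Both sides of [D] have even size, and s = s'. A 2+0 split makes s both nonzero and zero; a 4+0
    split makes a sum and its sum of cubes vanish, against [power_sums4]; a 2+2 split yields a zero
    of the form in [no_norm_root] at t = a + b + r with s nonzero. *)
Lemma syndrome_separated x y : syndrome x = syndrome y -> x != y -> (6 <= hamming x y)%N.
Proof.
case=> /side_parity evA /side_parity evB.
rewrite !(power_sum_support _ _ x y) hammingE -card_side.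
set D := diff x y in evA evB *; set r := power_sum true 1 (support x).
set s := power_sum true 1 D; set s' := power_sum false 1 D.
set c := power_sum true 3 D; set c' := power_sum false 3 D => e1 e3 xy.
have ss' : s = s'.
  apply/eqP; rewrite -(addr_eq0_self two0); apply/eqP.
  by apply: (addrI (r + power_sum false 1 (support x))); rewrite addr0 [LHS]addrACA.
have cc' : c + c' = r ^+ 2 * s + r * s ^+ 2 + s ^+ 3.
  apply/eqP; rewrite -(addr_eq0_self two0).
  have : c + c' + (r + s) ^+ 3 - r ^+ 3 = 0.
    move/eqP: e3; rewrite eq_sym -subr_eq0 => /eqP <-; ring.
  have -> : c + c' + (r + s) ^+ 3 - r ^+ 3 = c + c' + (r ^+ 2 * s + r * s ^+ 2 + s ^+ 3)
     + 2%:R * (r ^+ 2 * s + r * s ^+ 2) by ring.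
  by rewrite two0 mul0r addr0 => ->.
have D0 : (0 < #|side true D| + #|side false D|)%N.
  by rewrite card_side -hammingE lt0n hamming_eq0.
have empty b k : #|side b D| = 0%N -> power_sum b k D = 0.
  by move/eqP; rewrite cards_eq0 => /eqP h; rewrite /power_sum h big_set0.
have two b : #|side b D| = 2 -> exists a t, [/\ t != 0, power_sum b 1 D = t
  & power_sum b 3 D = a ^+ 2 * t + a * t ^+ 2 + t ^+ 3].
  by apply: (power_sums2 two0 (@side_inj b D)).
have four b : #|side b D| = 4 -> power_sum b 1 D = 0 -> power_sum b 3 D != 0.
  by apply: (power_sums4 two0 (@side_inj b D)).
rewrite leqNgt; apply/negP => lt6.
have [[A B]|[[A B]|[[A B]|[[A B]|[A B]]]]] :
  (#|side true D| = 2 /\ #|side false D| = 0) \/ (#|side true D| = 0 /\ #|side false D| = 2) \/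
  (#|side true D| = 4 /\ #|side false D| = 0) \/ (#|side true D| = 0 /\ #|side false D| = 4) \/
  (#|side true D| = 2 /\ #|side false D| = 2).
- move: #|side true D| #|side false D| evA evB D0 lt6 => p q; lia.
- by have [a [t [t0 st _]]] := two _ A; move: t0; rewrite -st -/s ss' /s' empty ?eqxx.
- by have [a [t [t0 st _]]] := two _ B; move: t0; rewrite -st -/s' -ss' /s empty ?eqxx.
- have s0 : s = 0 by rewrite ss' /s' empty.
  have c0 : c = 0 by move: cc'; rewrite s0 /c' (empty false) // !expr0n /= !mulr0 !addr0.
  by have := four _ A s0; rewrite -/c c0 eqxx.
- have s0 : s = 0 by rewrite /s empty.
  have c0 : c' = 0 by move: cc'; rewrite s0 /c (empty true) // !expr0n /= !mulr0 !addr0 add0r.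
  by have := four _ B; rewrite -/s' -/c' -ss' c0 eqxx => /(_ s0).
- have [a [t [t0 st ct]]] := two _ A; have [b [t' [_ st' ct']]] := two _ B.
  have et : s = t by []; have et' : s = t' by rewrite ss'.
  move: cc'; rewrite /c /c' ct ct' -et -et' => h.
  have /eqP : s * ((a + b + r) ^+ 2 + (a + b + r) * s + s ^+ 2) = 0.
    have -> : s * ((a + b + r) ^+ 2 + (a + b + r) * s + s ^+ 2) =
      (a ^+ 2 * s + a * s ^+ 2 + s ^+ 3 + (b ^+ 2 * s + b * s ^+ 2 + s ^+ 3))
      + (r ^+ 2 * s + r * s ^+ 2 + s ^+ 3) + 2%:R * (s * (a * b + a * r + b * r) - s ^+ 3) by ring.
    by rewrite h two0 mul0r addr0 (addr_self two0).
  rewrite mulf_eq0 et (negPf t0) => /eqP /no_norm_root tz.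
  by rewrite tz eqxx in t0.
Qed.

End Construction.

Lemma large_separated_family m : 0 < m -> ~~ odd m ->
  exists (I : finType) (u : I -> word (2 ^ m)),
    separated u /\ 2 ^ (2 ^ m) <= (2 ^ m) ^ 2 * #|I|.
Proof.
case: m => // -[//|m] _ em.
have [F char2 cardF] := pPrimePowerField (isT : prime 2) (ltn0Sn m).
have two0 : (2%:R = 0 :> F)%R by apply: (pcharf0 char2).
have q3 : 2 ^ m.+1 %% 3 = 2.
  rewrite /= negbK in em; rewrite -(odd_double_half m) (negPf em) add0n expnS -mul2n expnM.
  by rewrite -modnMmr -modnXm exp1n.
have cube_inj : injective (fun x : F => x ^+ 3)%R.
  (* With q = |F| = 2 mod 3, 3t = 2q - 1 and x^(3t) = x^q x^(q-1) = x, so the [t]-th power inverts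
     cubing. *)
  pose t := (2 ^ m.+1).*2 %/ 3.
  suff K (x : F) : ((x ^+ 3) ^+ t = x)%R by move=> x y /= exy; rewrite -(K x) exy K.
  rewrite -exprM; have -> : 3 * t = #|F| + #|F|.-1 by rewrite cardF; lia.
  by rewrite exprD expf_card -exprS prednK ?expf_card // cardF expn_gt0.
have cardT : 2 ^ m.+2 = #|{: bool * F}| by rewrite card_prod card_bool cardF -expnS.
pose e i := enum_val (cast_ord cardT i).
have e_inj : injective e by move=> i j /enum_val_inj /cast_ord_inj.
have [t large] := large_fiber (syndrome e) (zero_word _).
exists {x | syndrome e x == t}, val; split.
  move=> x y xy; apply: (syndrome_separated two0 cube_inj e_inj) => //.
  by rewrite (eqP (valP x)) (eqP (valP y)).
rewrite card_sig; apply: leq_trans (_ : #|{: word (2 ^ m.+2)}| <= _).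
  by rewrite card_ffun card_bool card_ord.
apply: leq_trans large _; rewrite !card_prod !card_bool cardF.
(* The number of syndromes is 4 (n/2)^2 = n^2. *)
rewrite (_ : 2 * 2 * 2 ^ m.+1 * 2 ^ m.+1 = (2 ^ m.+2) ^ 2) ?leq_mul2l.
  by rewrite cardsE leqnn orbT.
by rewrite (expnS 2 m.+1); lia.
Qed.

(** * Preparata codes *)

Section Codes.
Variables (n : nat) (P : {set word n}).

Lemma code_distance_unique d d' : code_distance P d -> code_distance P d' -> d = d'.
Proof.
move=> [[x [y [xP yP xy exy]]] dmin] [[x' [y' [x'P y'P xy' exy']]] dmin'].
apply/eqP; rewrite eqn_leq; apply/andP; split.
  by rewrite -exy' dmin.
by rewrite -exy dmin'.
Qed.

Lemma code_distance_separated (f : {x | x \in P} -> word n) (C : {set word n}) :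
  code_distance C 6 -> injective f -> (forall a, f a \in C) -> separated f.
Proof. by move=> [_ dmin] f_inj fC a b ab; apply: dmin; rewrite ?inj_eq. Qed.

Lemma covering_neighbor (I : finType) (u : I -> word n) (a : I) :
  4 < n -> covering u -> exists b, hamming (u a) (u b) = 6.
Proof.
move=> n5 ucov; have /card_gt0P [S] : 0 < #|[set S : {set 'I_n} | #|S| == 3]|.
  by rewrite card_draws card_ord bin_gt0; lia.
rewrite inE => /eqP S3; have /card_gt1P [j [k [+ + jk]]] : 1 < #|~: S|.
  by have := cardsC S; rewrite card_ord S3; lia.
by rewrite !inE => jS kS; have [b []] := ucov a S j k S3 jS kS jk; exists b.
Qed.

Lemma preparata_mod3 : preparata P -> n %% 3 = 1.
Proof.
case=> -[m [_ em en]] _; rewrite en -(even_halfK em) -mul2n expnM.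
by rewrite -modnXm exp1n.
Qed.

(** The constructed family competes in the maximality of [P]. That it attains distance 6 follows
    from its own covering property. *)
Lemma preparata_large : preparata P -> 2 ^ n <= n ^ 2 * #|P|.
Proof.
move=> Pprep; have n3 := preparata_mod3 Pprep; case: Pprep => -[m [m4 em en]] [_ Pmax].
have := large_separated_family (ltnW (ltnW (ltnW m4))) em.
rewrite -en => -[I [u [usep large]]]; apply: (leq_trans large); rewrite leq_mul2l; apply/orP; right.
have u_inj : injective u.
  by move=> a b eab; apply/eqP; apply: contraT => /usep; rewrite eab hammingxx.
rewrite -cardsT -(card_imset _ u_inj); apply: Pmax; split; last first.
  move=> _ _ /imsetP [a _ ->] /imsetP [b _ ->] ab; apply: usep.
  by apply: contra_neq ab => ->.
have /card_gt0P [a _] : 0 < #|I|.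
  by rewrite lt0n; apply: contraTneq large => ->; rewrite muln0 -ltnNge expn_gt0.
have n5 : 4 < n by rewrite en -[4]/(2 ^ 2) ltn_exp2l //; apply: ltnW.
have [b ab6] := covering_neighbor a n5 (separated_covering usep n3 large).
exists (u a), (u b); split; rewrite ?imset_f //.
by apply: contra_eq_neq ab6 => ->; rewrite hammingxx.
Qed.

End Codes.

Theorem theorem3 (n : nat) (P1 P2 : {set word n}) :
  preparata P1 -> preparata P2 ->
  (min_dist_graph_iso P1 P2 <-> isometric P1 P2).
Proof.
move=> prep1 prep2; have n3 := preparata_mod3 prep1.
have [_ [dist1 max1]] := prep1; have [_ [dist2 max2]] := prep2.
split.
  move=> [d1 [d2 [/(code_distance_unique dist1) <- [/(code_distance_unique dist2) <-]]]].
  move=> [f [f_inj f_im f_adj]].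
  have f_in x : x \in P1 -> f x \in P2 by move=> xP; rewrite -f_im imset_f.
  exists f; split => // x y xP yP.
  (* The graph isomorphism is itself the isometry; both codes are indexed by the codewords of
     [P1]. *)
  have v_inj : injective (fun a : {x | x \in P1} => f (val a)).
    by move=> a b eab; apply/val_inj/f_inj; rewrite ?(valP a) ?(valP b).
  have usep := code_distance_separated dist1 val_inj (fun a => valP a).
  have vsep := code_distance_separated dist2 v_inj (fun a => f_in _ (valP a)).
  have large : 2 ^ n <= n ^ 2 * #|{: {x | x \in P1}}|.
    by rewrite card_sig preparata_large.
  have adj (a b : {x | x \in P1}) :
      (hamming (val a) (val b) == 6) = (hamming (f (val a)) (f (val b)) == 6).
    by rewrite f_adj ?(valP a) ?(valP b).
  exact: (min_dist_graph_iso_isometry usep (separated_covering usep n3 large)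
    vsep (separated_covering vsep n3 large) adj (exist _ x xP) (exist _ y yP)).
move=> [f [f_in f_dist]]; exists 6, 6; do 2 split => //.
have f_inj : {in P1 &, injective f}.
  move=> x y xP yP exy; apply/eqP; rewrite -hamming_eq0 -f_dist // exy.
  by rewrite hammingxx.
exists f; split => //; last by move=> x y xP yP; rewrite f_dist.
(* Surjectivity comes from maximality of [P1]: the image lies in [P2] and has |P1| >= |P2|
   elements. *)
apply/eqP; rewrite eqEcard card_in_imset // max1 // andbT.
by apply/subsetP => _ /imsetP [x xP ->]; apply: f_in.
Qed.
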